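(* Suppose $\lambda\in\mathbb{N}_0^N$ is a partition ($\lambda_1\geq\cdots\geq\lambda_N$) and $\kappa_0\in\mathbb{Q}$, $\kappa_0<0$. If there does not exist $\beta\in\mathbb{N}_0^N$ such that $(\lambda,\beta)$ is a $\kappa_0$-critical pair, then $\kappa_0$ is not a pole of $\zeta_\lambda^x$ restricted to $\mathbb{R}^N$ (i.e. no coefficient of the $N$-variable polynomial $\zeta^x_\lambda$ has a pole at $\kappa=\kappa_0$).
   Context: $\kappa$ is a formal parameter (transcendental over $\mathbb{Q}$); polynomials in $x=(x_1,\ldots,x_N)$ have coefficients in $\mathbb{Q}(\kappa)$. For $w\in S_N$, $(xw)_i=x_{w(i)}$ and $wf(x)=f(xw)$; $(i,j)$ denotes a transposition. Dunkl operators: $\mathcal{D}_i f(x)=\frac{\partial}{\partial x_i}f(x)+\kappa\sum_{j\neq i}\frac{f(x)-(i,j)f(x)}{x_i-x_j}$. Set $\mathcal{U}_i f=\mathcal{D}_i(x_i f)-\kappa\sum_{j=1}^{i-1}(j,i)f$, $1\leq i\leq N$. For $\alpha\in\mathbb{N}_0^N$: $|\alpha|=\sum\alpha_i$, $\alpha^+$ is the nonincreasing rearrangement of $\alpha$. $\alpha\succ\beta$ means $\alpha\neq\beta$ and $\sum_{i=1}^j\alpha_i\geq\sum_{i=1}^j\beta_i$ for $1\leq j\leq N$; $\alpha\vartriangleright\beta$ means $|\alpha|=|\beta|$ and either $\alpha^+\succ\beta^+$, or $\alpha^+=\beta^+$ and $\alpha\succ\beta$. $r(\alpha,i)=\#\{j:\alpha_j>\alpha_i\}+\#\{j:1\leq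 j\leq i,\alpha_j=\alpha_i\}$ and $\xi_i(\alpha)=(N-r(\alpha,i))\kappa+\alpha_i+1$. The $x$-monic nonsymmetric Jack polynomial $\zeta_\alpha^x$ is the unique polynomial $\zeta_\alpha^x=x^\alpha+\sum_{\alpha\vartriangleright\beta}A^x_{\beta\alpha}x^\beta$, $A^x_{\beta\alpha}\in\mathbb{Q}(\kappa)$, with $\mathcal{U}_i\zeta^x_\alpha=\xi_i(\alpha)\zeta^x_\alpha$ for $1\leq i\leq N$. Critical pairs: let $\alpha,\beta\in\mathbb{N}_0^N$ with $\alpha\vartriangleright\beta$, and let $m,n$ be positive integers with $\gcd(m,n)=1$. $(\alpha,\beta)$ is a $\left(-\frac mn\right)$-critical pair if $n\kappa+m$ divides $(r(\beta,i)-r(\alpha,i))\kappa+\alpha_i-\beta_i$ in $\mathbb{Q}[\kappa]$ for $1\leq i\leq N$. *)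

(* Defs.v *)
From HB Require Import structures.
From mathcomp Require Import all_boot all_order all_algebra perm.
From mathcomp Require Export fraction.
From mathcomp.multinomials Require Export mpoly.

Set Implicit Arguments.
Unset Strict Implicit.
Unset Printing Implicit Defensive.

Import GRing.Theory Num.Theory.

Local Open Scope ring_scope.

Notation Qkappa := {fraction {poly rat}}.

Definition kappa : Qkappa := tofrac ('X : {poly rat}).

(* Being a pole is read off the fraction in lowest terms. *)
Definition has_pole (k0 : rat) (c : Qkappa) : Prop :=
  exists p q : {poly rat},
    [/\ q != 0, coprimep p q, c = tofrac p / tofrac q & root q k0].

Section Operators.

Variable N : nat.

Notation pol := {mpoly Qkappa[N]}.

Definition transp (i j : 'I_N) (f : pol) : pol := msym (tperm i j) f.

(* The value of the operator is the fraction given by the defining formula; it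
   always lies in the image of the polynomials, because x_i - x_j divides
   f - (i,j)f. *)
Definition dunkl (i : 'I_N) (f : pol) : {fraction pol} :=
  tofrac (mderiv i f) +
  tofrac (kappa%:MP : pol) *
    \sum_(j < N | j != i) tofrac (f - transp i j f) / tofrac ('X_i - 'X_j : pol).

Definition Uop (i : 'I_N) (f : pol) : {fraction pol} :=
  dunkl i ('X_i * f) - tofrac (kappa *: \sum_(j < N | (j < i)%N) transp j i f).

End Operators.

Section Compositions.

Variable N : nat.
Implicit Types a b : 'X_{1..N}.

Definition is_partition a : Prop :=
  forall i j : 'I_N, (i <= j)%N -> (a j <= a i)%N.

Definition rearr a : 'X_{1..N} := [multinom nth 0%N (sort geq a) i | i < N].

Definition dominates a b : bool :=
  (a != b) &&
  [forall j : 'I_N,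
     (\sum_(i < N | (i <= j)%N) b i <= \sum_(i < N | (i <= j)%N) a i)%N].

Definition triangleright a b : bool :=
  (mdeg a == mdeg b) &&
  (dominates (rearr a) (rearr b) || ((rearr a == rearr b) && dominates a b)).

(* Ranks run over 1..N although indices run over 0..N-1: the second set always
   contains i itself. *)
Definition rk a (i : 'I_N) : nat :=
  (#|[set j : 'I_N | (a i < a j)%N]| +
   #|[set j : 'I_N | (j <= i)%N && (a j == a i)]|)%N.

Definition xi a (i : 'I_N) : Qkappa :=
  (N%:R - (rk a i)%:R) * kappa + (a i)%:R + 1.

Definition is_xmonic_jack a (zeta : {mpoly Qkappa[N]}) : Prop :=
  [/\ zeta@_a = 1,
      forall b, zeta@_b != 0 -> b != a -> triangleright a b
    & forall i : 'I_N, Uop i zeta = tofrac (xi a i *: zeta)].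

Definition critical_pair (k0 : rat) a b : Prop :=
  triangleright a b /\
  exists m n : nat,
    [/\ (0 < m)%N, (0 < n)%N, coprime m n, k0 = - (m%:R / n%:R)
      & forall i : 'I_N,
          (n%:R *: 'X + m%:R%:P : {poly rat}) %|
            ((rk b i)%:R - (rk a i)%:R) *: 'X + ((a i)%:R - (b i)%:R)%:P].

End Compositions.

(* Main.v *)
(* Each U_i is triangular on monomials: the coefficient of x^b in U_i x^a is
   xi_i(a) if b = a, and otherwise vanishes unless b is strictly below a, in
   any order where an exponent goes down when two of its entries are moved
   strictly closer together with constant sum, or when a larger entry is swapped
   with a smaller one to its right.
   Suppose zeta has a pole at k0, multiply it by the least common denominator
   and put kappa = k0.  The result f is nonzero, has no x^lambda term, and
   satisfies U_i f = xi_i(lambda)(k0) f at kappa = k0.  Comparing coefficients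
   at a maximal exponent b of f gives xi_i(b)(k0) = xi_i(lambda)(k0) for all i,
   that is, (lambda, b) is a k0-critical pair. *)
Require Import Defs.
From mathcomp Require Import all_boot all_order all_algebra.
From mathcomp Require Import perm generic_quotient ring lra zify.

Set Implicit Arguments.
Unset Strict Implicit.
Unset Printing Implicit Defensive.

Import Order.TTheory GRing.Theory Num.Theory.

Local Open Scope ring_scope.

(** * Changing two entries of an exponent, and the weights that order exponents *)

Section Replacement.

Variable N : nat.
Implicit Types (a b : 'X_{1..N}) (i j k : 'I_N).

Definition upd i j a u v : 'X_{1..N} :=
  [multinom if k == i then u else if k == j then v else a k | k < N].

Lemma updE i j a u v k :
  upd i j a u v k = if k == i then u else if k == j then v else a k.
Proof. by rewrite mnmE. Qed.

Lemma upd_id i j a : upd i j a (a i) (a j) = a.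
Proof.
by apply/mnmP => k; rewrite updE; case: eqP => [->|_] //; case: eqP => [->|].
Qed.

Lemma upd_neq i j a u v : u != a i -> upd i j a u v != a.
Proof. by apply: contraNneq => /mnmP /(_ i); rewrite updE eqxx => ->. Qed.

Lemma sum_upd (h : 'I_N -> nat -> nat) i j a u v : j != i ->
  (\sum_k h k (upd i j a u v k) =
   h i u + (h j v + \sum_(k | (k != i) && (k != j)) h k (a k)))%N.
Proof.
move=> ji; rewrite (bigD1 i) //= (bigD1 j) //= !updE eqxx (negPf ji) eqxx.
congr (_ + (_ + _))%N; apply: eq_bigr => k /andP[/negPf ki /negPf kj].
by rewrite updE ki kj.
Qed.

Lemma sum_split2 (h : 'I_N -> nat -> nat) i j a : j != i ->
  (\sum_k h k (a k) =
   h i (a i) + (h j (a j) + \sum_(k | (k != i) && (k != j)) h k (a k)))%N.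
Proof. by move=> /(sum_upd h a (a i) (a j)); rewrite upd_id. Qed.

(** The factor with exponent [upd i j a 0 0] collects the other variables, so identities among such
    monomials reduce to identities in two variables. *)
Lemma mpolyX_upd (R : comNzRingType) i j a u v : j != i ->
  'X_[upd i j a u v] = 'X_[upd i j a 0 0] * 'X_i ^+ u * 'X_j ^+ v
    :> {mpoly R[N]}.
Proof.
move=> ji; rewrite !mpolyXn -!mpolyXD; congr 'X_[_]; apply/mnmP => k.
rewrite !mnmDE !mulmnE !mnmE (eq_sym k i) (eq_sym k j).
have [<-|ik] := eqVneq i k; first by rewrite (negPf ji) /=; lia.
by have [jk|jk] := eqVneq j k; rewrite /=; lia.
Qed.

Lemma msym_upd (R : comNzRingType) i j a u v : j != i ->
  msym (tperm i j) ('X_[upd i j a u v] : {mpoly R[N]}) = 'X_[upd i j a v u].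
Proof.
move=> ji; rewrite msymX tpermV; congr 'X_[_]; apply/mnmP => k.
rewrite mnmE !updE; case: tpermP => [->|->|/eqP/negPf-> /eqP/negPf->] //.
  by rewrite (negPf ji) !eqxx.
by rewrite (negPf ji) !eqxx.
Qed.

(* Any order making the U_i triangular will do, because the support condition
   on zeta already provides [triangleright lambda b]; comparing these two weights
   avoids the combinatorics of dominance. *)
Definition sqweight a : nat := (\sum_k (a k) ^ 2)%N.
Definition linweight a : nat := (\sum_(k < N) (N - k) * a k)%N.

Definition heavier a b : bool :=
  (sqweight b < sqweight a)%N ||
  ((sqweight b == sqweight a) && (linweight b < linweight a)%N).

Lemma heavier_irr a : ~~ heavier a a.
Proof. by rewrite /heavier !ltnn andbF. Qed.

(** With [x = a i] and [y = a j], the sum of squares drops by [2 (x - c) (c - y)], which is positive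
    for [c] strictly between [x] and [y]. *)
Lemma heavier_between i j a c : j != i ->
  (minn (a i) (a j) < c < maxn (a i) (a j))%N ->
  heavier a (upd i j a c (a i + a j - c)).
Proof.
move=> ji hc; apply/orP; left; pose sq (_ : 'I_N) x := (x ^ 2)%N.
rewrite /sqweight (sum_upd sq) // (sum_split2 sq a ji) !addnA ltn_add2r /sq.
set x := a i in hc *; set y := a j in hc *.
have xyc : (x + y = c + (x + y - c))%N by lia.
(* Subtraction is truncated: the first product is positive if [x < c < y], the second if
   [y < c < x], and the other one is then zero. *)
by have : (0 < (c - x) * (y - c) + (x - c) * (c - y))%N; nia.
Qed.

(** Squares are unchanged by a swap, while the decreasing factors [N - k] make the linear weight
    drop by [(j - i) (a i - a j)]. *)
Lemma heavier_swap i j a : (i < j)%N -> (a j < a i)%N ->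
  heavier a (upd i j a (a j) (a i)).
Proof.
move=> ij aij; have ji : j != i by rewrite -val_eqE /=; lia.
pose sq (_ : 'I_N) x := (x ^ 2)%N.
pose lin (k : 'I_N) x := ((N - k) * x)%N.
apply/orP; right; rewrite /sqweight /linweight.
rewrite (sum_upd sq) // (sum_upd lin) //.
rewrite (sum_split2 sq a ji) (sum_split2 lin a ji) /sq /lin.
rewrite !addnA ltn_add2r eqn_add2r addnC eqxx /=.
have := ltn_ord j; nia.
Qed.

Lemma upd_swapC i j a u v : j != i -> upd i j a u v = upd j i a v u.
Proof.
move=> ji; apply/mnmP => k; rewrite !updE.
by have [->|] := eqVneq k i; rewrite ?(eq_sym i j) ?(negPf ji).
Qed.

End Replacement.

Lemma heaviest N (s : seq 'X_{1..N}) : s != [::] ->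
  exists2 b, b \in s & forall a, a \in s -> ~~ heavier a b.
Proof.
elim: s => // x s IH _; have [->|/IH[b bs hb]] := eqVneq s [::].
  by exists x; rewrite ?mem_head // => a /[!inE] /eqP->; apply: heavier_irr.
have [xb|xb] := boolP (heavier x b); last first.
  by exists b => [|a]; rewrite inE ?bs ?orbT // => /predU1P[->|/hb].
exists x; rewrite ?mem_head // => a /predU1P[->|/hb ab]; first exact: heavier_irr.
by move: xb ab; rewrite /heavier; lia.
Qed.

(** * Divided differences and the action of the operators on monomials *)

Lemma mulB_between_exprs (R : comNzRingType) (x y : R) (p q : nat) :
  (q < p)%N ->
  (x - y) * \sum_(q.+1 <= c < p) x ^+ c * y ^+ (p + q - c) =
  x ^+ p * y ^+ q.+1 - x ^+ q.+1 * y ^+ p.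
Proof.
(* Each summand times [x - y] is [F c.+1 - F c], so the sum telescopes. *)
move=> qp; pose F c := x ^+ c * y ^+ ((p + q).+1 - c).
have -> : x ^+ p * y ^+ q.+1 - x ^+ q.+1 * y ^+ p = F p - F q.+1.
  by congr (_ * y ^+ _ - _ * y ^+ _); lia.
rewrite mulr_sumr -telescope_sumr //; apply: eq_big_nat => c hc.
rewrite /F subSS [X in _ = _ - _ * _ ^+ X]subSn; last lia.
rewrite !exprS; ring.
Qed.

Section MonomialAction.

Variables (N : nat) (R : comNzRingType).
Implicit Types (a b : 'X_{1..N}) (i j k : 'I_N).

Definition between i j a : {mpoly R[N]} :=
  \sum_((minn (a i) (a j)).+1 <= c < maxn (a i) (a j))
     'X_[upd i j a c (a i + a j - c)].

(* (x_i x^a - (i,j)(x_i x^a)) / (x_i - x_j) *)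
Definition divdiff i j a : {mpoly R[N]} :=
  (a j <= a i)%N%:R *: 'X_[a] + (a j < a i)%N%:R *: 'X_[upd i j a (a j) (a i)]
  + (-1) ^+ (a i < a j)%N *: between i j a.

(** The quotient is a geometric sum. Because of the extra factor ['X_i], the exponents of ['X_i] run
    from [a j] to [a i], both ends included, if [a j <= a i]; if [a i < a j] they lie strictly
    between, with a minus sign. *)
Lemma mulB_divdiff i j a : j != i ->
  ('X_i - 'X_j) * divdiff i j a = 'X_i * 'X_[a] - msym (tperm i j) ('X_i * 'X_[a]).
Proof.
move=> ji; rewrite msymM.
have -> : msym (tperm i j) ('X_i : {mpoly R[N]}) = 'X_j.
  rewrite msymX tpermV; congr 'X_[_]; apply/mnmP => k; rewrite !mnmE.
  by congr (nat_of_bool _); rewrite -(inj_eq (@perm_inj _ (tperm i j)))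
    tpermK tpermL eq_sym [in RHS]eq_sym.
have -> : msym (tperm i j) ('X_[a] : {mpoly R[N]}) = 'X_[upd i j a (a j) (a i)].
  by rewrite -[X in 'X_[X]](upd_id i j a) msym_upd.
have [M hM] : exists M : {mpoly R[N]}, forall u v,
    'X_[upd i j a u v] = M * ('X_i ^+ u * 'X_j ^+ v).
  by exists 'X_[upd i j a 0 0] => u v; rewrite mulrA mpolyX_upd.
have := hM (a i) (a j); rewrite upd_id => ha.
rewrite /divdiff /between ha; under eq_bigr do rewrite hM.
rewrite -mulr_sumr hM; set x := 'X_i; set y := 'X_j.
case: (ltngtP (a i) (a j)) => aij; rewrite ?scale0r ?scale1r ?add0r ?addr0 /=.
- have := mulB_between_exprs x y aij; rewrite addnC.
  set S := \sum_(_ <= _ < _) _ => hS.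
  rewrite ?expr1 scaleN1r mulrN mulrCA hS !exprS; ring.
- have := mulB_between_exprs x y aij.
  set S := \sum_(_ <= _ < _) _ => hS.
  rewrite ?expr0 ?scale1r mulrDr [X in _ + X = _]mulrCA hS !exprS; ring.
rewrite aij big_geq; last lia.
by rewrite !mulr0 addr0; ring.
Qed.

Lemma mcoeff_between i j a b : j != i -> ~~ heavier a b -> (between i j a)@_b = 0.
Proof.
move=> ji ab; rewrite raddf_sum /= big_nat big1 // => c hc.
rewrite mcoeffX; case: eqP => // eb; case/negP: ab; rewrite -eb.
exact: heavier_between.
Qed.

(* The part of U_i x^a coming from the index j; for j < i the term -(j,i)x^a
   cancels the swapped monomial of [divdiff] when a_j < a_i. *)
Definition Upair i j a : {mpoly R[N]} :=
  divdiff i j a - (j < i)%N%:R *: 'X_[upd i j a (a j) (a i)].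

Lemma mcoeff_Upair i j a b : j != i -> ~~ heavier a b ->
  (Upair i j a)@_b = (a j <= a i)%N%:R * (a == b)%:R
    + ((a j < a i)%N%:R - (j < i)%N%:R) * (upd i j a (a j) (a i) == b)%:R.
Proof.
move=> ji ab; rewrite /Upair mcoeffB !mcoeffD !mcoeffZ mcoeff_between //.
by rewrite !mcoeffX; ring.
Qed.

(** Only the swapped monomial could contribute, with coefficient [[a j < a i] - [j < i]]. When the
    two entries differ and this is nonzero, the larger entry stands on the left, so the swap lowers
    the exponent. *)
Lemma mcoeff_Upair_neq i j a b : j != i -> ~~ heavier a b -> a != b ->
  (Upair i j a)@_b = 0.
Proof.
move=> ji ab /negPf aneb; rewrite mcoeff_Upair // aneb mulr0 add0r.
have ijn : (j != i :> nat) by [].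
case: eqP => [eb|_]; last by rewrite mulr0.
case: (ltngtP (a j) (a i)) eb => [aji|aij|eaij] eb.
- have [jlti|ij] := ltnP j i; first by rewrite subrr mul0r.
  by case/negP: ab; rewrite -eb heavier_swap //; lia.
- have [jlti|ij] := ltnP j i; last by rewrite subrr mul0r.
  by case/negP: ab; rewrite -eb upd_swapC // heavier_swap.
- by case/eqP: aneb; rewrite -eb eaij -{2}eaij upd_id.
Qed.

Lemma mcoeff_Upair_diag i j a : j != i ->
  (Upair i j a)@_a = (a j <= a i)%N%:R - ((j < i) && (a j == a i))%N%:R.
Proof.
move=> ji; rewrite mcoeff_Upair ?heavier_irr // eqxx mulr1.
have -> : (upd i j a (a j) (a i) == a) = (a j == a i).
  case: (eqVneq (a j) (a i)) => [e|/(upd_neq j (a i))/negPf//].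
  by have := upd_id i j a; rewrite e => ->; rewrite !eqxx.
by case: (ltngtP (a j) (a i)) => _; rewrite ?andbF ?andbT /= ?mulr0 ?mulr1
  ?sub0r ?subr0 ?oppr0 ?addr0 ?add0r.
Qed.

Definition Umon (kp : R) i a : {mpoly R[N]} :=
  (a i).+1%:R *: 'X_[a] + kp *: \sum_(j | j != i) Upair i j a.

Definition xi_at (kp : R) a i : R :=
  (N%:R - (rk a i)%:R) * kp + (a i)%:R + 1.

Lemma mcoeff_Umon_neq kp i a b : ~~ heavier a b -> a != b ->
  (Umon kp i a)@_b = 0.
Proof.
move=> ab aneb; rewrite mcoeffD !mcoeffZ mcoeffX (negPf aneb) mulr0 add0r.
by rewrite raddf_sum /= big1 ?mulr0 // => j ji; rewrite mcoeff_Upair_neq.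
Qed.

Lemma mcoeff_Umon_diag kp i a : (Umon kp i a)@_a = xi_at kp a i.
Proof.
rewrite mcoeffD !mcoeffZ mcoeffX eqxx mulr1 raddf_sum /=.
under eq_bigr => j ji do rewrite mcoeff_Upair_diag //.
(* A [j] other than [i] contributes 1 to the sum exactly when it is ranked after [i], and otherwise
   it is counted in [rk a i]; the index [i] itself is counted once, in the rank. *)
rewrite /xi_at; suff -> : N%:R = (rk a i)%:R + \sum_(j < N | j != i)
    ((a j <= a i)%N%:R - ((j < i) && (a j == a i))%N%:R) :> R.
  by rewrite -natr1; ring.
have cardE (P : pred 'I_N) : #|[set j | P j]|%:R = \sum_j (P j)%:R :> R.
  by rewrite -sum1dep_card big_mkcond natr_sum; apply: eq_bigr => j _; case: (P j).
rewrite /rk natrD !cardE [X in _ + X]big_mkcond.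
rewrite -!big_split /= -{1}(card_ord N) -sum1_card natr_sum.
apply: eq_bigr => j _.
have [->|ji] := eqVneq j i; first by rewrite ltnn leqnn eqxx /= add0r addr0.
have {ji}: (j != i :> nat) by [].
by case: (ltngtP j i) => // _ _; case: (ltngtP (a j) (a i)) => //= _;
  rewrite ?subr0 ?addr0 ?add0r ?subrr ?addr0.
Qed.

End MonomialAction.

(** The coefficients are integer polynomials in [kp]. This serves for the embedding of Q[kappa] in
    Q(kappa) and for the evaluation of Q[kappa] at [kappa0]. *)
Lemma rmorph_mcoeff_Umon N (R S : comNzRingType) (h : {rmorphism R -> S})
    (kp : R) i (a b : 'X_{1..N}) :
  h (Umon kp i a)@_b = (Umon (h kp) i a)@_b.
Proof.
rewrite /Umon !mcoeffD !mcoeffZ !mcoeffX !raddf_sum /=.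
rewrite rmorphD !rmorphM !rmorph_nat rmorph_sum.
congr (_ + _ * _); apply: eq_bigr => j _.
rewrite /Upair /divdiff /between !mcoeffB !mcoeffD !mcoeffZ !raddf_sum /= !mcoeffX.
rewrite rmorphB !rmorphD !rmorphM !rmorph_nat rmorph_sum rmorphXn rmorphN rmorph1.
by do 2!congr (_ + _); congr (_ * _); apply: eq_bigr => c _; rewrite !mcoeffX rmorph_nat.
Qed.

Lemma msym_sum N (R : nzRingType) (s : {perm 'I_N}) (T : Type) (r : seq T)
    (F : T -> {mpoly R[N]}) :
  msym s (\sum_(x <- r) F x) = \sum_(x <- r) msym s (F x).
Proof. exact: raddf_sum. Qed.

Lemma rmorph_xi_at N (R S : comNzRingType) (h : {rmorphism R -> S}) (kp : R)
    (a : 'X_{1..N}) i :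
  h (xi_at kp a i) = xi_at (h kp) a i.
Proof.
rewrite /xi_at; move: (rk a i) => r.
by rewrite !rmorphD rmorphM rmorphB !rmorph_nat rmorph1.
Qed.

(** * The operators on Q(kappa)-polynomials, as linear extensions of [Umon] *)

Section UopPolynomial.

Variables (N : nat).
Implicit Types (f : {mpoly Qkappa[N]}) (i j : 'I_N).

Lemma mulB_sum_divdiff f i j : j != i ->
  'X_i * f - transp i j ('X_i * f) =
  (\sum_(a <- msupp f) f@_a *: divdiff _ i j a) * ('X_i - 'X_j).
Proof.
move=> ji; rewrite {1 2}[f]mpolyE mulr_sumr /transp.
rewrite msym_sum -sumrB mulr_suml.
apply: eq_bigr => a _; rewrite -scalerAr msymZ -scalerBr -scalerAl.
by rewrite -mulB_divdiff // [_ * divdiff _ _ _ _]mulrC.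
Qed.

Lemma mderiv_mulX (R : comNzRingType) i (a : 'X_{1..N}) :
  mderiv i ('X_i * 'X_[a]) = (a i).+1%:R *: 'X_[a] :> {mpoly R[N]}.
Proof.
rewrite -mpolyXD mderivX mnmDE mnm1E eqxx; congr (_ *: 'X_[_]).
by apply/mnmP => k; rewrite mnmBE mnmDE addKn.
Qed.

Lemma Uop_sum i f :
  Uop i f = tofrac (\sum_(a <- msupp f) f@_a *: Umon kappa i a).
Proof.
have dd : \sum_(j < N | j != i)
      tofrac ('X_i * f - transp i j ('X_i * f))
        / tofrac ('X_i - 'X_j : {mpoly Qkappa[N]}) =
    tofrac (\sum_(j < N | j != i)
      \sum_(a <- msupp f) f@_a *: divdiff Qkappa i j a).
  rewrite rmorph_sum; apply: eq_bigr => j ji.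
  rewrite mulB_sum_divdiff // rmorphM mulfK // tofrac_eq0 subr_eq0.
  apply/eqP => /(congr1 (mcoeff U_(i))); rewrite !mcoeffX eqxx.
  have -> : (U_(j)%MM == U_(i)%MM :> 'X_{1..N}) = false.
    apply/negbTE/eqP => /mnmP /(_ i); rewrite !mnmE eqxx.
    by rewrite (negPf ji).
  by move/eqP; rewrite oner_eq0.
rewrite /Uop /dunkl dd -rmorphM -rmorphD -rmorphB; congr tofrac.
under [RHS]eq_bigr => a _ do rewrite /Umon scalerDr.
rewrite big_split /= mul_mpolyC -addrA -scalerBr; congr (_ + _).
  rewrite {1}[f]mpolyE mulr_sumr raddf_sum /=; apply: eq_bigr => a _.
  by rewrite -scalerAr mderivZ mderiv_mulX.
under [RHS]eq_bigr => a _ do rewrite scalerA mulrC -scalerA.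
rewrite -scaler_sumr; congr (_ *: _).
under [RHS]eq_bigr => a _ do rewrite scaler_sumr.
rewrite [RHS]exchange_big /=.
(* Extending the sum to all [j != i] by an indicator lets each transposition join the divided
   difference of the same [j] in [Upair]. *)
have -> : \sum_(j < N | (j < i)%N) transp j i f =
    \sum_(j < N | j != i) \sum_(a <- msupp f)
       f@_a *: ((j < i)%N%:R *: 'X_[upd i j a (a j) (a i)]).
  rewrite [LHS]big_mkcond [RHS]big_mkcond; apply: eq_bigr => j _.
  have [->|ji] := eqVneq j i; first by rewrite ltnn.
  case: ifP => _ /=; last by rewrite big1 // => a _; rewrite scale0r scaler0.
  rewrite /transp {1}[f]mpolyE msym_sum; apply: eq_bigr => a _.
  by rewrite scale1r msymZ tpermC -[X in msym _ 'X_[X]](upd_id i j a) msym_upd.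
rewrite -sumrB; apply: eq_bigr => j _; rewrite -sumrB.
by apply: eq_bigr => a _; rewrite scalerBr.
Qed.

End UopPolynomial.

(** * Common denominators and poles *)

Lemma fraction_repr (R : idomainType) (c : {fraction R}) :
  exists n d : R, d != 0 /\ c * tofrac d = tofrac n.
Proof.
elim/quotW: c => x; exists x.1, x.2; split; first exact: denom_ratioP.
rewrite !piE; apply/eqmodP; rewrite /= FracField.equivfE.
by rewrite !numden_Ratio ?mulf_neq0 ?oner_neq0 ?denom_ratioP // !mulr1 mulrC.
Qed.

Lemma common_denominator (R : idomainType) (T : eqType) (s : seq T)
    (c : T -> {fraction R}) :
  exists (D : R) (P : T -> R), D != 0 /\
    forall x, x \in s -> c x * tofrac D = tofrac (P x).
Proof.
elim: s => [|x s [D [P [D0 hP]]]]; first by exists 1, (fun=> 0); rewrite oner_neq0.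
have [n [d [d0 hn]]] := fraction_repr (c x).
exists (D * d), (fun y => if y == x then D * n else d * P y).
split=> [|y]; first by rewrite mulf_neq0.
rewrite inE rmorphM; have [->|_ /= ys] := eqVneq y x.
  by rewrite mulrCA hn -rmorphM.
by rewrite mulrA hP // mulrC -rmorphM.
Qed.

(** A denominator minimal at [k0] suffices: as long as it and all numerators vanish there, the
    factor ['X - k0] is cancelled and the size of [D] drops. *)
Lemma reduced_denominator (F : fieldType) (k0 : F) (T : eqType) (s : seq T)
    (c : T -> {fraction {poly F}}) :
  exists (D : {poly F}) (P : T -> {poly F}),
    [/\ D != 0, forall x, x \in s -> c x * tofrac D = tofrac (P x)
      & root D k0 -> has (fun x => ~~ root (P x) k0) s].
Proof.
have [D [P [D0 hP]]] := common_denominator s c.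
elim: {D}(size D) {-2}D (leqnn (size D)) P D0 hP => [|n IH] D sD P D0 hP.
  by case/negP: D0; rewrite -size_poly_leq0.
have [rD|rD] := boolP (root D k0); last by exists D, P; split=> // /(negP rD).
have [hs|] := boolP (has (fun x => ~~ root (P x) k0) s); first by exists D, P.
rewrite -all_predC => /allP hs.
pose q : {poly F} := 'X - k0%:P; have q0 : q != 0 by rewrite polyXsubC_eq0.
have qD : D %/ q * q = D by rewrite divpK // dvdp_XsubCl.
have D'0 : D %/ q != 0 by apply: contraNneq D0 => D'; rewrite -qD D' mul0r.
apply: (IH (D %/ q) _ (fun x => P x %/ q)) => // [|x xs].
  by rewrite size_divp // size_XsubC leq_subLR.
have qP : P x %/ q * q = P x.
  by rewrite divpK // dvdp_XsubCl; have := hs x xs; rewrite /= negbK.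
apply: (mulIf (x := tofrac q)); first by rewrite tofrac_eq0.
by rewrite -mulrA -!rmorphM qD qP hP.
Qed.

(** If [c = p / q] in lowest terms, then [p * D = P * q], so [q] divides [D] and its roots are roots
    of [D]. *)
Lemma not_pole (k0 : rat) (c : Qkappa) (D P : {poly rat}) : ~~ root D k0 ->
  c * tofrac D = tofrac P -> ~ has_pole k0 c.
Proof.
move=> rD cD [p [q [q0 pq cE qk0]]]; case/negP: rD.
suff qD : q %| D by rewrite -dvdp_XsubCl (dvdp_trans _ qD) ?dvdp_XsubCl.
have <- : (q %| p * D) = (q %| D) by rewrite Gauss_dvdpr // coprimep_sym.
suff -> : p * D = P * q by apply: dvdp_mulIr.
apply/eqP; rewrite -tofrac_eq !tofracM -cD cE -!mulrA; apply/eqP; congr (_ * _).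
by rewrite mulrCA mulVf ?mulr1 // tofrac_eq0.
Qed.

(** * From equal eigenvalues at a negative rational to critical pairs *)

Lemma neg_rat_frac (k0 : rat) : k0 < 0 ->
  exists m n : nat, [/\ (0 < m)%N, (0 < n)%N, coprime m n & k0 = - (m%:R / n%:R)].
Proof.
move=> k0_lt0; exists `|numq k0|%N, `|denq k0|%N.
rewrite !absz_gt0 denq_neq0 numq_eq0 lt_eqF // coprime_num_den; split=> //.
rewrite !pmulrn absz_denq abszE ltr0_norm ?numq_lt0 // rmorphN /= mulNr opprK.
by rewrite divq_num_den.
Qed.

(** Since [n 'X + m = n ('X - k0)], divisibility means vanishing at [k0], and the linear form to be
    divided is the difference of the eigenvalues of [a] and [b]. *)
Lemma critical_pair_of_xi N (k0 : rat) (a b : 'X_{1..N}) : k0 < 0 ->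
  triangleright a b -> (forall i, xi_at k0 b i = xi_at k0 a i) ->
  critical_pair k0 a b.
Proof.
move=> k0_lt0 ab hxi; split=> //.
have [m [n [m0 n0 mn k0E]]] := neg_rat_frac k0_lt0.
exists m, n; split=> // i.
have n0' : n%:R != 0 :> rat by rewrite pnatr_eq0 -lt0n.
have -> : n%:R *: 'X + m%:R%:P = n%:R *: ('X - k0%:P) :> {poly rat}.
  rewrite scalerBr -[_ *: k0%:P]mul_polyC -polyCM k0E.
  by rewrite mulrN mulrCA divff // mulr1 polyCN opprK.
rewrite dvdpZl // dvdp_XsubCl /root hornerD hornerZ hornerX hornerC.
apply/eqP; have := hxi i; rewrite /xi_at; lra.
Qed.

Theorem theorem3 (N : nat) (lambda : 'X_{1..N}) (kappa0 : rat)
  (hlambda : is_partition lambda) (hkappa0 : kappa0 < 0)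
  (hcrit : ~ exists beta : 'X_{1..N}, critical_pair kappa0 lambda beta)
  (zeta : {mpoly Qkappa[N]}) (hzeta : is_xmonic_jack lambda zeta) :
  forall beta : 'X_{1..N}, ~ has_pole kappa0 (zeta@_beta).
Proof.
case: hzeta => zeta1 zeta_tri zeta_eigen beta.
have [D [P [D0 hP Dmin]]] :=
  reduced_denominator kappa0 (msupp zeta) (fun b => zeta@_b).
have [rD|rD] := boolP (root D kappa0); last first.
  have [/hP|/memN_msupp_eq0->] := boolP (beta \in msupp zeta).
    exact: not_pole.
  by apply: (not_pole (P := 0) rD); rewrite mul0r rmorph0.
pose ev : {rmorphism {poly rat} -> rat} := horner_eval kappa0.
have evX : ev 'X = kappa0 by apply: hornerX.
case: hcrit; pose f b := ev (P b).
(* The eigenvalue equation is multiplied by [D], pulled back to Q[kappa] by injectivity of [tofrac],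
   then evaluated. Since [P] is controlled only on the support of [zeta], [b] is taken there. *)
have f_eigen i b : b \in msupp zeta ->
    \sum_(a <- msupp zeta) f a * (Umon kappa0 i a)@_b = xi_at kappa0 lambda i * f b.
  move=> bs; have /eqP := zeta_eigen i; rewrite Uop_sum tofrac_eq => /eqP.
  move=> /(congr1 (fun p : {mpoly Qkappa[N]} => p@_b * tofrac D)).
  rewrite mcoeffZ raddf_sum /= mulr_suml -mulrA hP //.
  have -> : xi lambda i = tofrac (xi_at 'X lambda i).
    by rewrite rmorph_xi_at.
  rewrite -tofracM.
  under eq_big_seq => a ais.
    rewrite mcoeffZ mulrAC hP // -[kappa]/(tofrac 'X).
    rewrite -rmorph_mcoeff_Umon -tofracM; over.
  rewrite -rmorph_sum => /eqP; rewrite tofrac_eq => /eqP.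
  move=> /(congr1 ev); rewrite rmorph_sum rmorphM rmorph_xi_at evX => <-.
  by apply: eq_bigr => a _; rewrite rmorphM rmorph_mcoeff_Umon evX.
have [b] : exists2 b, b \in [seq b <- msupp zeta | f b != 0] &
    forall a, a \in [seq b <- msupp zeta | f b != 0] -> ~~ heavier a b.
  by apply: heaviest; rewrite -has_filter; apply: Dmin.
rewrite mem_filter => /andP[fb bs] bmax; exists b.
(* The leading coefficient is 1, so [P lambda = D], which vanishes at [kappa0]; hence [b] is not
   [lambda]. *)
have flambda : f lambda = 0.
  have ls : lambda \in msupp zeta by rewrite mcoeff_msupp zeta1 oner_neq0.
  have /eqP := hP _ ls; rewrite zeta1 mul1r tofrac_eq /f => /eqP <-.
  exact/eqP.
apply: critical_pair_of_xi => // [|i].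
  apply: zeta_tri; first by rewrite -mcoeff_msupp.
  by apply: contraNneq fb => ->; rewrite flambda.
apply: (mulIf fb); rewrite -f_eigen // mulrC -mcoeff_Umon_diag.
(* For any other [a], either [f a = 0] or maximality of [b] gives [~~ heavier a b], so only the
   diagonal term survives. *)
rewrite (bigD1_seq b) //= big1_seq ?addr0 // => a /andP[ab az].
have [fa0|fa] := eqVneq (f a) 0; first by rewrite fa0 mul0r.
by rewrite mcoeff_Umon_neq ?mulr0 // bmax // mem_filter fa.
Qed.
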